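(* Let $X$ be a real Hilbert space of finite dimension $d$, let $\alpha\in(0,1)$, let $T:X\to X$ be $\alpha$-averaged, let $\hat x\in X$ with $T\hat x=\hat x$, let $0\leq\alpha_k\leq(1-\alpha)/\alpha$ for all $k$, and let the sequence $(x_k)$ (with auxiliary sequence $(\bar x_k)$) be defined from $x_0\in X$ by $$x_{k+1}=T\bar x_k,\qquad \bar x_k=\begin{cases}x_k&\text{if }k\text{ is even},\\ x_k+\alpha_k(x_k-x_{k-1})&\text{if }k\text{ is odd}.\end{cases}$$ Let $M\in\mathbb{N}$ with $M\geq\|x_k-\hat x\|$ and $M\geq\|\bar x_k-\hat x\|$ for all $k$, let $X_0=\overline{B}(\hat x,M)$ and $AF_k=\{x\in X_0\mid\|x-Tx\|\leq\frac1{k+1}\}$. Then $(x_n)$ is Cauchy and for all $k\in\mathbb{N}$ and $g:\mathbb{N}\to\mathbb{N}$: $$\exists N\leq\Psi(k,g)\ \forall i,j\in[N;N+g(N)]\ \Big(\|x_i-x_j\|\leq\tfrac1{k+1}\text{ and }x_i\in AF_k\Big)$$ where $\Psi(k,g)=2\Psi_0(P,2k+1,g')+3$ with $P=\big\lceil(64k+64)\sqrt d\,M\big\rceil^d$, $g'(n)=g(n+3)+3$, and, for arbitrary $k\in\mathbb{N}$ and $g:\mathbb{N}\to\mathbb{N}$, $$\Psi_0(0,k,g)=0,\qquad \Psi_0(n+1,k,g)=\Phi^M\big(\eta^M_{g,k}(\Psi_0(n,k,g),4k+3)\big),$$ $$\Phi(k)=2\max\Big\{1,\Big\lceil\tfrac{\alpha}{1-\alpha}M^2(k+1)^2\Big\rceil\Big\}+1,\qquad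 \Phi^M(k)=\max\{\Phi(j)\mid j\leq k\},$$ $$\eta_{g,k}(n,r)=\max\Big\{2k+1,\ 2\Big\lfloor\tfrac{g(2n)}2\Big\rfloor^2\Big\lceil\tfrac{3-\alpha}{\alpha^2}+4\Big\rceil M(2r+4)^2\mathbin{\dot-}1\Big\},\qquad \eta^M_{g,k}(n,r)=\max\{\eta_{g,k}(i,r)\mid i\leq n\}.$$
   Context: $\mathbb{N}=\{0,1,2,\dots\}$; $n\mathbin{\dot-}m=\max\{0,n-m\}$; $[a;b]=\{a,a+1,\dots,b\}$; $\overline B(\hat x,M)$ is the closed ball. $T$ is $\alpha$-averaged if $(1-\alpha)\|(Id-T)x-(Id-T)y\|^2\leq\alpha\big(\|x-y\|^2-\|Tx-Ty\|^2\big)$ for all $x,y\in X$. *)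

(* Defs.v *)
From HB Require Import structures.
From mathcomp Require Import all_boot all_order all_algebra.
From mathcomp Require Import reals.

Set Implicit Arguments.
Unset Strict Implicit.
Unset Printing Implicit Defensive.

Import Order.TTheory GRing.Theory Num.Theory.

Local Open Scope ring_scope.

(* A d-dimensional real Hilbert space is a [vectType] over a [realType] whose
   full space has dimension d, with a positive definite symmetric bilinear form
   [dot : {dot X for idfun}]. Completeness is automatic in finite dimension. *)
Definition hnorm (R : realType) (X : vectType R) (dot : {dot X for idfun})
  (x : X) : R := Num.sqrt (dot x x).

Definition averaged (R : realType) (X : vectType R) (dot : {dot X for idfun})
    (alpha : R) (T : X -> X) : Prop :=
  forall x y : X,
    (1 - alpha) * hnorm dot ((x - T x) - (y - T y)) ^+ 2
      <= alpha * (hnorm dot (x - y) ^+ 2 - hnorm dot (T x - T y) ^+ 2).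

Definition cauchy_sequence (R : realType) (X : vectType R)
    (dot : {dot X for idfun}) (x : nat -> X) : Prop :=
  forall e : R, 0 < e -> exists N : nat, forall i j : nat,
    (N <= i)%N -> (N <= j)%N -> hnorm dot (x i - x j) < e.

Definition cball (R : realType) (X : vectType R) (dot : {dot X for idfun})
  (c : X) (r : R) : {pred X} := [pred x | hnorm dot (x - c) <= r].

Definition AF (R : realType) (X : vectType R) (dot : {dot X for idfun})
    (T : X -> X) (X0 : {pred X}) (k : nat) : {pred X} :=
  [pred x | (x \in X0) && (hnorm dot (x - T x) <= k.+1%:R^-1)].

(* Natural-number ceiling, only used on nonnegative arguments. *)
Definition nceil (R : realType) (x : R) : nat := `|Num.ceil x|%N.

Section Rate.
Variables (R : realType) (alpha : R) (M : nat).
Local Open Scope nat_scope.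

Definition Phi (k : nat) : nat :=
  2 * maxn 1 (nceil (alpha / (1 - alpha) * M%:R ^+ 2 * k.+1%:R ^+ 2)%R) + 1.

Definition PhiM (k : nat) : nat := \max_(j < k.+1) Phi j.

Definition eta (g : nat -> nat) (k n r : nat) : nat :=
  maxn (2 * k + 1)
    (2 * (g (2 * n) %/ 2) ^ 2 * nceil ((3 - alpha) / alpha ^+ 2 + 4)%R
       * M * (2 * r + 4) ^ 2 - 1).

Definition etaM (g : nat -> nat) (k n r : nat) : nat :=
  \max_(i < n.+1) eta g k i r.

Fixpoint Psi0 (n k : nat) (g : nat -> nat) : nat :=
  if n is n'.+1 then PhiM (etaM g k (Psi0 n' k g) (4 * k + 3)) else 0.

Definition Psi (d k : nat) (g : nat -> nat) : nat :=
  let P := nceil ((64 * k + 64)%N%:R * Num.sqrt d%:R * M%:R : R)%R ^ d in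
  2 * Psi0 P (2 * k + 1) (fun n => g (n + 3) + 3) + 3.

End Rate.

(* Main.v *)
Require Import Defs.
From HB Require Import structures.
From mathcomp Require Import all_boot all_order all_algebra.
From mathcomp Require Import boolp reals.
From mathcomp Require Import zify ring lra.

Set Implicit Arguments.
Unset Strict Implicit.

Import Order.TTheory GRing.Theory Num.Theory.
Local Open Scope ring_scope.

(** Write N for the nonexpansive map with T = (1 - alpha) Id + alpha N. An odd
    step of the scheme replaces y = x_{2n} by an extrapolation
    y - c (y - T y) with 1 <= c <= 1 / alpha, which is the point
    (1 - c alpha) y + c alpha N y and hence again depends nonexpansively on y.
    So the even iterates y_n = x_{2n} obey y_{n+1} = S_n y_n, where
    S_n = T o (extrapolation) is nonexpansive and fixes xhat.

    Two quantitative facts follow. First, averagedness applied at the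
    extrapolated points makes their squared residuals summable with total at
    most alpha / (1 - alpha) M^2, so the even sequence meets a 1 / (K + 1)
    approximate fixed point by time Phi K ([approximate_fixed_point]).
    Second, S_n moves a point q by at most (1 + 1 / alpha) |q - T q|, so l steps
    increase the distance to q by at most l times that amount
    ([even_almost_fejer]); the modulus eta is large enough to absorb this over
    the window prescribed by g ([eta_modulus]).

    Metastability is then a pigeonhole argument. Choose times f 0, f 1, ...,
    f P with f n <= Psi0 n, such that y_{f n} is an approximate fixed point of a
    quality that suits the windows starting at all earlier f i
    ([approximate_fixed_point_chain]). In orthonormal coordinates the ball of
    radius M is covered by P small boxes, so among these P + 1 points two,
    y_{f i} and y_{f j} with i < j, are close ([ball_pigeonhole]). By the second
    fact, y stays near the approximate fixed point y_{f j} during the whole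
    window starting at f i; the odd iterates T y_n stay there too, and points
    near an approximate fixed point are approximate fixed points. The Cauchy
    property follows from metastability by contradiction: a failure of the
    former supplies a function g that refutes the latter
    ([metastable_cauchy]). *)

(** * Geometry of the inner product *)

Section Geometry.
Variables (R : realType) (X : vectType R) (dot : {dot X for idfun}).
Implicit Types (u v w x y z : X) (c : R).
Local Notation norm := (hnorm dot).

Lemma dotC u v : dot u v = dot v u.
Proof. by rewrite hermC expr0 mul1r. Qed.

Lemma dot_gt0 u : u != 0 -> 0 < dot u u.
Proof. exact: neq0_dnorm_gt0. Qed.

Lemma dot_ge0 u : 0 <= dot u u.
Proof. by have [->|/dot_gt0/ltW//] := eqVneq u 0; rewrite linear0l. Qed.

Lemma hnorm_ge0 u : 0 <= norm u.
Proof. exact: sqrtr_ge0. Qed.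

Lemma hnorm_sqr u : norm u ^+ 2 = dot u u.
Proof. by rewrite sqr_sqrtr // dot_ge0. Qed.

Lemma hnorm0 : norm 0 = 0.
Proof. by rewrite /hnorm linear0l sqrtr0. Qed.

Lemma hnorm_le0 u : norm u <= 0 -> u = 0.
Proof.
move=> u0; apply/eqP/negP => /negP/dot_gt0.
rewrite -hnorm_sqr (_ : norm u = 0) ?expr0n ?ltxx //.
by apply/le_anti; rewrite u0 hnorm_ge0.
Qed.

Lemma hnorm_scale c u : norm (c *: u) = `|c| * norm u.
Proof.
by rewrite /hnorm linearZl_LR linearZr_LR /= mulrA -expr2 sqrtrM ?sqr_ge0 // sqrtr_sqr.
Qed.

Lemma hnorm_opp u : norm (- u) = norm u.
Proof. by rewrite /hnorm (hnormN dot). Qed.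

Lemma hnorm_distC u v : norm (u - v) = norm (v - u).
Proof. by rewrite -opprB hnorm_opp. Qed.

Lemma hnorm_sqrB u v : norm (u - v) ^+ 2 = norm u ^+ 2 - 2 * dot u v + norm v ^+ 2.
Proof.
by rewrite !hnorm_sqr !(linearBl, linearBr) /= (dotC v u); ring.
Qed.

(** Obtained by expanding the square of |v| u - |u| v. *)
Lemma cauchy_schwarz u v : dot u v <= norm u * norm v.
Proof.
have [v0|v0] := eqVneq (norm v) 0.
  by rewrite (hnorm_le0 (u := v)) ?v0 // linear0r hnorm0 mulr0.
have v_gt0 : 0 < norm v by rewrite lt_def v0 hnorm_ge0.
have [u0|u0] := eqVneq (norm u) 0.
  by rewrite (hnorm_le0 (u := u)) ?u0 // linear0l hnorm0 mul0r.
have u_gt0 : 0 < norm u by rewrite lt_def u0 hnorm_ge0.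
have := sqr_ge0 (norm (norm v *: u - norm u *: v)).
rewrite hnorm_sqrB !hnorm_scale linearZl_LR linearZr_LR /=.
rewrite !ger0_norm ?hnorm_ge0 //.
set p := norm u in u_gt0 *; set q := norm v in v_gt0 *.
rewrite (_ : _ + _ = 2 * (p * q) * (p * q - dot u v)); last by ring.
by rewrite pmulr_rge0 ?subr_ge0 // !mulr_gt0.
Qed.

Lemma ler_hnormD u v : norm (u + v) <= norm u + norm v.
Proof.
rewrite -(@ler_pXn2r _ 2) ?nnegrE ?addr_ge0 ?hnorm_ge0 //.
have := hnorm_sqrB u (- v); rewrite opprK => ->.
rewrite hnorm_opp linearNr sqrrD.
by have := cauchy_schwarz u v; lra.
Qed.

Lemma ler_hdist w u v : norm (u - v) <= norm (u - w) + norm (v - w).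
Proof. by rewrite (hnorm_distC v) -{1}(subrK w u) -addrA ler_hnormD. Qed.

(** * Orthonormal systems and total boundedness of balls *)

(** Systems are indexed by all of [nat], with a bound, so that adding a vector
    does not change the index type. *)
Definition orthonormal_upto n (e : nat -> X) :=
  forall i j, (i < n)%N -> (j < n)%N -> dot (e i) (e j) = (i == j)%:R.

Definition projection n (e : nat -> X) v := \sum_(i < n) dot v (e i) *: e i.

Lemma dot_projection n e v j : orthonormal_upto n e -> (j < n)%N ->
  dot (projection n e v) (e j) = dot v (e j).
Proof.
move=> on jn; rewrite /projection linear_sumlz.
rewrite (bigD1 (Ordinal jn)) //= linearZl_LR /= on // eqxx mulr1 big1 ?addr0 //.
move=> i ij; rewrite linearZl_LR /= on // (negPf (_ : (i : nat) != j)) ?mulr0 //.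
Qed.

(** One Gram-Schmidt step. *)
Lemma orthonormal_extend n e v : orthonormal_upto n e ->
  v - projection n e v != 0 -> exists e', orthonormal_upto n.+1 e'.
Proof.
move=> on; set w := v - _ => w0.
have we j : (j < n)%N -> dot w (e j) = 0.
  by move=> jn; rewrite linearBl /= dot_projection // subrr.
have ww : dot w w != 0 by rewrite gt_eqF // dot_gt0.
exists (fun i => if (i < n)%N then e i else (norm w)^-1 *: w) => i j.
rewrite !ltnS => le_in le_jn.
case: ltnP => ltin; case: ltnP => ltjn; first exact: on.
- rewrite linearZr_LR /= dotC we // mulr0 (_ : i == j = false) //; lia.
- rewrite linearZl_LR /= we // mulr0 (_ : i == j = false) //; lia.
rewrite linearZl_LR linearZr_LR /= mulrA -expr2 exprVn hnorm_sqr mulVf //.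
by rewrite (_ : i == j) //; lia.
Qed.

(** Taking the inner product of a linear relation with e_j isolates its j-th coefficient. *)
Lemma orthonormal_size n e : orthonormal_upto n e -> (n <= \dim {:X})%N.
Proof.
move=> on; set s := [tuple e i | i < n].
suff fs : free s by move: fs; rewrite /free size_tuple => /eqP <-; rewrite dimvS ?subvf.
apply/freeP => k; have se i : s`_(i : 'I_n) = e i by rewrite -tnth_nth tnth_mktuple.
move=> ks j; have := congr1 (fun v => dot v (e j)) ks.
rewrite linear_sumlz linear0l (bigD1 j) //= se linearZl_LR /= on // eqxx mulr1.
rewrite big1 ?addr0 // => i ij; rewrite se linearZl_LR /= on //.
by rewrite (negPf (_ : (i : nat) != j)) ?mulr0.
Qed.

(** As long as n is below the dimension, some vector lies outside the span of
    the system, so a Gram-Schmidt step is possible. *)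
Lemma orthonormal_exists n : (n <= \dim {:X})%N -> exists e, orthonormal_upto n e.
Proof.
elim: n => [|n IHn] ltn; first by exists (fun=> 0).
have [e on] := IHn (ltnW ltn).
have /subvPn [v _ vs] : ~~ ({:X} <= <<[tuple e i | i < n]>>)%VS.
  apply/negP => /dimvS le_dim; have := dim_span [tuple e i | i < n].
  by rewrite size_tuple; move: (leq_trans ltn le_dim); lia.
apply: (orthonormal_extend on (v := v)).
rewrite subr_eq0; apply: contraNneq vs => ->.
apply: memv_suml => i _; apply/memvZ/memv_span/tnthP.
by exists i; rewrite tnth_mktuple.
Qed.

(** A vector that differs from its projection would extend the system beyond
    the dimension of the space. *)
Lemma parseval e v : orthonormal_upto (\dim {:X}) e ->
  norm v ^+ 2 = \sum_(i < \dim {:X}) dot v (e i) ^+ 2.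
Proof.
move=> on; have /eqP : v - projection (\dim {:X}) e v == 0.
  apply: contraPT isT => /(orthonormal_extend on) [e' /orthonormal_size].
  by rewrite ltnn.
move/eqP; rewrite subr_eq0 => /eqP vE.
rewrite hnorm_sqr {2}vE linear_sumr.
by apply: eq_bigr => i _; rewrite linearZr_LR.
Qed.

Lemma truncn_eq_dist (s t : R) : 0 <= s -> 0 <= t ->
  Num.truncn s = Num.truncn t -> (s - t) ^+ 2 <= 1.
Proof.
move=> s0 t0 st; have := truncn_itv s0; have := truncn_itv t0; rewrite st -natr1.
by nra.
Qed.

(** Coordinates lie in an interval of length 2 r; cutting it into pieces of
    length eps / sqrt d gives boxes of diameter eps, and the bound on B says that
    B pieces suffice in each direction. *)
Lemma ball_pigeonhole (d : nat) (z : X) (r eps : R) (B : nat) (y : nat -> X) :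
  \dim {:X} = d -> 0 < eps -> 2 * r * Num.sqrt d%:R < eps * B%:R ->
  (forall n, norm (y n - z) <= r) ->
  exists i j, [/\ (i < j)%N, (j <= B ^ d)%N & norm (y i - y j) <= eps].
Proof.
move=> dimd eps_gt0 ltB yr.
have [e on] := orthonormal_exists (leqnn (\dim {:X})); rewrite dimd in on.
(* Rescaled and shifted coordinates t: boxes become unit cubes with integral
   corners, so that the box of a point is read off with [Num.truncn]. *)
pose s := Num.sqrt (d%:R : R) / eps.
have s_ge0 : 0 <= s by rewrite divr_ge0 ?sqrtr_ge0 // ltW.
pose t n i := (dot (y n - z) (e i) + r) * s.
have coordN n (i : 'I_d) : - r <= dot (y n - z) (e i) <= r.
  rewrite -ler_norml; apply: le_trans (yr n).
  have e1 : norm (e i) = 1 by rewrite /hnorm on // eqxx sqrtr1.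
  rewrite ler_norml lerNl -linearNl /=.
  have := cauchy_schwarz (y n - z) (e i); have := cauchy_schwarz (- (y n - z)) (e i).
  by rewrite e1 !mulr1 hnorm_opp => -> ->.
have t_ge0 n (i : 'I_d) : 0 <= t n i.
  by rewrite mulr_ge0 //; have := coordN n i; lra.
have ltnB n (i : 'I_d) : (Num.truncn (t n i) < B)%N.
  rewrite truncn_lt_nat //; apply: (@le_lt_trans _ _ ((r + r) * s)).
    by rewrite ler_wpM2r //; have := coordN n i; lra.
  by rewrite /s mulrA ltr_pdivrMr // (_ : r + r = 2 * r) 1?[ltRHS]mulrC //; ring.
pose box (n : 'I_(B ^ d).+1) := [ffun i : 'I_d => Ordinal (ltnB n i)].
have /injectivePn [i [j ij boxij]] : ~~ injectiveb box.
  apply/negP => /injectiveP/leq_card.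
  by rewrite card_ffun !card_ord ltnn.
have dist_ij : norm (y i - y j) <= eps.
  rewrite -(@ler_pXn2r _ 2) ?nnegrE ?hnorm_ge0 ?(ltW eps_gt0) //.
  rewrite (parseval _ (e := e)) dimd //.
  have [d0|d_gt0] := posnP d.
    by rewrite big1 ?sqr_ge0 // => l; have := ltn_ord l; lia.
  have d_gt0R : 0 < (d%:R : R) by rewrite ltr0n.
  rewrite -(ler_pM2l d_gt0R) mulr_sumr.
  have -> : d%:R * eps ^+ 2 = \sum_(l < d) eps ^+ 2.
    by rewrite sumr_const card_ord mulr_natl.
  apply: ler_sum => l _.
  have /ffunP/(_ l) := boxij; rewrite !ffunE => /(congr1 val) /= tij.
  have := truncn_eq_dist (t_ge0 i l) (t_ge0 j l) tij.
  have -> : t i l - t j l = dot (y i - y j) (e l) * s.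
    have -> : y i - y j = (y i - z) - (y j - z) by rewrite opprB addrA subrK.
    by rewrite linearBl /= /t -mulrBl [- (_ + r)]opprD addrACA subrr addr0.
  rewrite exprMn /s expr_div_n sqr_sqrtr ?ler0n //.
  rewrite mulrA ler_pdivrMr ?exprn_gt0 //.
  by rewrite mul1r [leLHS]mulrC.
case: (ltngtP i j) => [lt_ij|lt_ji|/val_inj eq_ij].
- by exists i, j; split; rewrite // -ltnS.
- by exists j, i; split; rewrite -1?ltnS // hnorm_distC.
- by rewrite eq_ij eqxx in ij.
Qed.

End Geometry.

(** * Averaged operators and their relaxations *)

Section AveragedOperators.
Variables (R : realType) (X : vectType R) (dot : {dot X for idfun}).
Variables (alpha : R) (T : X -> X).
Hypotheses (halpha : 0 < alpha < 1) (hT : averaged dot alpha T).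
Implicit Types (u v p q : X) (c e : R).
Local Notation norm := (hnorm dot).

(** For c > 1 this is the extrapolation T u + (c - 1) (T u - u) used in the odd steps. *)
Definition relax c u := u - c *: (u - T u).

Lemma relax1 u : relax 1 u = T u.
Proof. by rewrite /relax scale1r subKr. Qed.

Lemma relaxB c u v :
  relax c u - relax c v = (u - v) - c *: ((u - T u) - (v - T v)).
Proof. by rewrite /relax [in RHS]scalerBr [in LHS]opprD addrACA -opprD. Qed.

(** With D = u - v and E = (u - T u) - (v - T v), averagedness is equivalent to
    |E|^2 <= 2 alpha <D, E>, and the claim, after expanding |D - c E|^2, follows
    from c |E|^2 <= 2 <D, E>. *)
Lemma relax_nonexpansive c u v : 0 <= c -> c * alpha <= 1 ->
  norm (relax c u - relax c v) <= norm (u - v).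
Proof.
have [a0 a1] := andP halpha; move=> c0 c1; rewrite -(@ler_pXn2r _ 2) ?nnegrE ?hnorm_ge0 //.
have := hT u v; rewrite -(relax1 u) -(relax1 v) !relaxB scale1r relax1 relax1.
move: (u - v) ((u - T u) - (v - T v)) => D E.
rewrite !hnorm_sqrB hnorm_scale linearZr_LR /= ger0_norm //.
rewrite exprMn.
have := sqr_ge0 (norm E).
set e := norm E ^+ 2; set w := dot D E; move=> e0 h.
have ew : e <= 2 * alpha * w by lra.
have w0 : 0 <= w by rewrite -(pmulr_rge0 _ a0); lra.
have cew : c * e <= 2 * w.
  apply: (@le_trans _ _ (c * (2 * alpha * w))); first by rewrite ler_wpM2l.
  rewrite (_ : _ * _ = c * alpha * (2 * w)); last by ring.
  by rewrite ler_piMl ?mulr_ge0.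
have : c * (c * e) <= c * (2 * w) by rewrite ler_wpM2l.
by lra.
Qed.

Lemma averaged_nonexpansive u v : norm (T u - T v) <= norm (u - v).
Proof.
rewrite -(relax1 u) -(relax1 v).
by apply: relax_nonexpansive; rewrite // mul1r ltW //; case/andP: halpha.
Qed.

Lemma relax_step_nonexpansive c u v : 0 <= c -> c * alpha <= 1 ->
  norm (T (relax c u) - T (relax c v)) <= norm (u - v).
Proof.
by move=> c0 c1; exact: le_trans (averaged_nonexpansive _ _) (relax_nonexpansive _ _ c0 c1).
Qed.

Lemma relax_step_drift c q : 0 <= c -> c * alpha <= 1 ->
  norm (T (relax c q) - q) <= (1 + alpha^-1) * norm (q - T q).
Proof.
move=> c0 c1; have a0 : 0 < alpha by case/andP: halpha.
have c_le : c <= alpha^-1 by rewrite -[_^-1]mul1r ler_pdivlMr.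
apply: le_trans (ler_hdist _ (T q) _ _) _.
apply: (@le_trans _ _ (c * norm (q - T q) + norm (q - T q))).
  rewrite lerD2r; apply: le_trans (averaged_nonexpansive _ _) _.
  by rewrite /relax addrAC subrr add0r hnorm_opp hnorm_scale ger0_norm.
by rewrite mulrDl mul1r addrC lerD2l ler_wpM2r ?hnorm_ge0.
Qed.

Lemma relax_fix c p : T p = p -> relax c p = p.
Proof. by rewrite /relax => ->; rewrite subrr scaler0 subr0. Qed.

Lemma averaged_residual u p : T p = p ->
  (1 - alpha) * norm (u - T u) ^+ 2 <=
    alpha * (norm (u - p) ^+ 2 - norm (T u - p) ^+ 2).
Proof. by move=> Tp; have := hT u p; rewrite !Tp subrr subr0. Qed.

(** The decrease of alpha |y_n - p|^2 in one step dominates (1 - alpha) times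
    the squared residual at z_n; telescoping bounds the sum of the squared
    residuals, so m of them cannot all exceed delta^2. *)
Lemma small_residual (y z : nat -> X) p (r delta : R) m :
  T p = p -> (forall n, y n.+1 = T (z n)) ->
  (forall n, norm (z n - p) <= norm (y n - p)) -> norm (y 0%N - p) <= r ->
  0 < delta -> (0 < m)%N -> alpha * r ^+ 2 <= (1 - alpha) * (m%:R * delta ^+ 2) ->
  exists2 n, (n < m)%N & norm (z n - T (z n)) <= delta.
Proof.
move=> Tp yS zy y0 delta0 m0 hm; have [a0 a1] := andP halpha.
have sum_le k : (1 - alpha) * \sum_(n < k) norm (z n - T (z n)) ^+ 2 <=
    alpha * (norm (y 0%N - p) ^+ 2 - norm (y k - p) ^+ 2).
  elim: k => [|k IHk]; first by rewrite big_ord0 mulr0 subrr mulr0.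
  rewrite big_ord_recr /= mulrDr.
  have := averaged_residual (z k) Tp; rewrite -yS.
  have : norm (z k - p) ^+ 2 <= norm (y k - p) ^+ 2.
    by rewrite ler_pXn2r ?nnegrE ?hnorm_ge0.
  by nra.
have [/'exists_idP[n]|/existsPn small] :=
  boolP [exists n : 'I_m, norm (z n - T (z n)) <= delta].
  by move=> ?; exists n.
have : \sum_(n < m) delta ^+ 2 < \sum_(n < m) norm (z n - T (z n)) ^+ 2.
  apply: ltr_sum; first by apply/hasP; exists (Ordinal m0); rewrite ?mem_index_enum.
  by move=> n _; rewrite ltr_pXn2r ?nnegrE ?hnorm_ge0 ?(ltW delta0) // ltNge small.
rewrite sumr_const card_ord -mulr_natl.
have := sum_le m; have := sqr_ge0 (norm (y m - p)).
have : norm (y 0%N - p) ^+ 2 <= r ^+ 2.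
  by rewrite ler_pXn2r ?nnegrE ?hnorm_ge0 // (le_trans (hnorm_ge0 _ _) y0).
by nra.
Qed.

(** Collects what is needed to treat even iterates u and odd iterates T u
    together. *)
Lemma near_approximate_fixed_point q u e : norm (q - T q) <= e ->
  norm (u - q) <= e ->
  [/\ norm (u - q) <= 2 * e, norm (T u - q) <= 2 * e,
      norm (u - T u) <= 4 * e & norm (T u - T (T u)) <= 4 * e].
Proof.
move=> qe ue.
have uTu : norm (u - T u) <= 4 * e.
  apply: le_trans (ler_hdist _ q _ _) _.
  have := ler_hdist dot (T q) (T u) q.
  by have := averaged_nonexpansive u q; have := hnorm_ge0 dot (u - q); lra.
split=> //.
- by have := hnorm_ge0 dot (u - q); lra.
- have := ler_hdist dot (T q) (T u) q.
  by have := averaged_nonexpansive u q; lra.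
- exact: le_trans (averaged_nonexpansive _ _) uTu.
Qed.

End AveragedOperators.

Lemma almost_fejer (R : realType) (X : vectType R) (dot : {dot X for idfun})
    (S : nat -> X -> X) (y : nat -> X) (q : X) (e : R) (n l : nat) :
  (forall m, y m.+1 = S m (y m)) ->
  (forall m u v, hnorm dot (S m u - S m v) <= hnorm dot (u - v)) ->
  (forall m, hnorm dot (S m q - q) <= e) ->
  hnorm dot (y (n + l)%N - q) <= hnorm dot (y n - q) + l%:R * e.
Proof.
move=> yS Sne Sq; elim: l => [|l IHl]; first by rewrite addn0 mul0r addr0.
rewrite addnS yS; apply: le_trans (ler_hdist _ (S (n + l)%N q) _ _) _.
rewrite -natr1 mulrDl mul1r addrA; apply: lerD; last by rewrite hnorm_distC.
exact: le_trans (Sne _ _ _) IHl.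
Qed.

(** * The rate functions *)

Lemma nceil_ge (R : realType) (t : R) : 0 <= t -> t <= (nceil t)%:R.
Proof.
move=> t0; rewrite /nceil natr_absz ger0_norm ?ceil_ge //.
by rewrite ceil_ge0 (lt_le_trans _ t0) // ltrN10.
Qed.

Section Rates.
Variables (R : realType) (alpha : R) (M : nat).
Local Open Scope nat_scope.

Lemma Phi_le_PhiM k : Phi alpha M k <= PhiM alpha M k.
Proof. exact: (leq_bigmax (F := fun j : 'I_k.+1 => Phi alpha M j) ord_max). Qed.

Lemma eta_le_etaM g k n i r : i <= n -> Defs.eta alpha M g k i r <= etaM alpha M g k n r.
Proof.
rewrite -ltnS => lt_in.
exact: (leq_bigmax (F := fun j : 'I_n.+1 => Defs.eta alpha M g k j r) (Ordinal lt_in)).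
Qed.

Lemma bigmax_ord_mono (F : nat -> nat) :
  {homo (fun n => \max_(i < n.+1) F i) : m n / m <= n}.
Proof.
move=> m n le_mn; apply/bigmax_leqP => i _.
have lt_in : i < n.+1 by rewrite (leq_trans (ltn_ord i)).
exact: (leq_bigmax (F := fun j : 'I_n.+1 => F j) (Ordinal lt_in)).
Qed.

(** Psi0 is not obviously increasing, since eta need not dominate its argument;
    but it iterates, from 0, a monotone map. *)
Lemma Psi0_mono k g : {homo (fun n => Psi0 alpha M n k g) : m n / m <= n}.
Proof.
apply: homo_leq => //=; first exact: leq_trans.
elim=> [//|n IHn]; rewrite /= in IHn *.
apply: (@bigmax_ord_mono (Phi alpha M)).
exact: (@bigmax_ord_mono (fun i => Defs.eta alpha M g k i _)).
Qed.

End Rates.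

(** The factor (3 - alpha) / alpha^2 + 4 dominates 1 + 1 / alpha, and the
    quadratic terms of eta dominate the linear ones used here; positivity of M
    keeps the product from vanishing. *)
Lemma eta_modulus (R : realType) (alpha : R) (M : nat) (g : nat -> nat) (k n r : nat) :
  0 < alpha < 1 -> (0 < M)%N ->
  (g (2 * n)%N %/ 2)%N%:R * ((1 + alpha^-1) * (Defs.eta alpha M g k n r).+1%:R^-1)
    <= r.+1%:R^-1.
Proof.
move=> /andP[a0 a1] M0; set L := (g _ %/ 2)%N.
rewrite mulrA ler_pdivrMr ?ltr0n // [leRHS]mulrC ler_pdivlMr ?ltr0n //.
have ia : alpha * alpha^-1 = 1 by rewrite divff ?gt_eqF.
have C_ge : 1 + alpha^-1 <= (nceil ((3 - alpha) / alpha ^+ 2 + 4))%:R.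
  have ge : 1 + alpha^-1 <= (3 - alpha) / alpha ^+ 2 + 4.
    rewrite -exprVn (_ : _ * _ = 3 * alpha^-1 ^+ 2 - alpha * alpha^-1 * alpha^-1);
      last by ring.
    by rewrite ia; have := sqr_ge0 (alpha^-1 - 1); nra.
  have ia0 : 0 < alpha^-1 by rewrite invr_gt0.
  by apply: (le_trans ge); apply: nceil_ge; apply: le_trans ge; lra.
set C := nceil _ in C_ge.
have : (L * C * r.+1 <= (Defs.eta alpha M g k n r).+1)%N.
  rewrite /Defs.eta -/L -/C; set Q := (2 * L ^ 2 * C * M * _)%N.
  have : (L * C * r.+1 <= Q)%N.
    have -> : Q = (2 * M * (L ^ 2 * C * (2 * r + 4) ^ 2))%N by rewrite /Q; ring.
    apply: (@leq_trans (L ^ 2 * C * (2 * r + 4) ^ 2)); last by rewrite leq_pmull // muln_gt0.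
    by rewrite !leq_mul // -mulnn; nia.
  by lia.
rewrite -(ler_nat R) !natrM; apply: le_trans.
by rewrite -!mulrA ler_wpM2l // ler_wpM2r.
Qed.

(** * Metastability *)

(** If the sequence is not Cauchy for e, choose for each N two indices beyond N at
    distance at least e, and let g N be their sum, so that the window at N
    contains both. *)
Lemma metastable_cauchy (R : realType) (X : vectType R) (dot : {dot X for idfun})
    (x : nat -> X) :
  (forall (k : nat) (g : nat -> nat), exists N : nat, forall i j : nat,
     (N <= i <= N + g N)%N -> (N <= j <= N + g N)%N ->
     hnorm dot (x i - x j) <= k.+1%:R^-1) ->
  cauchy_sequence dot x.
Proof.
move=> meta e e0; apply: contrapT => /forallNP far.
have /choice [f fP] : forall N, exists p : nat * nat,
    [/\ (N <= p.1)%N, (N <= p.2)%N & ~ hnorm dot (x p.1 - x p.2) < e].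
  move=> N; apply: contrapT => /forallNP close; apply: (far N) => i j Ni Nj.
  by apply: contrapT => ne; apply: (close (i, j)).
have [N NP] := meta (Num.truncn e^-1) (fun N => (f N).1 + (f N).2)%N.
have [N1 N2] := fP N; apply; apply: le_lt_trans (NP _ _ _ _) _; [lia|lia|].
by rewrite invf_plt ?posrE // truncnS_gt.
Qed.

Section Iteration.
Variables (R : realType) (X : vectType R) (dot : {dot X for idfun}) (d : nat).
Hypothesis hd : \dim {: X}%VS = d.
Variables (alpha : R) (T : X -> X).
Hypotheses (halpha : 0 < alpha < 1) (hT : averaged dot alpha T).
Variables (xhat : X) (a : nat -> R) (x xbar : nat -> X) (M : nat).
Hypotheses (hxhat : T xhat = xhat)
  (ha : forall k : nat, 0 <= a k <= (1 - alpha) / alpha)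
  (hx : forall k : nat, x k.+1 = T (xbar k))
  (hxbar : forall k : nat,
     xbar k = if odd k then x k + a k *: (x k - x k.-1) else x k)
  (hMx : forall k : nat, hnorm dot (x k - xhat) <= M%:R).
Local Notation norm := (hnorm dot).

Let y n := x n.*2.
Let c n := 1 + a n.*2.+1.
Let z n := relax T (c n) (y n).

Lemma odd_iterate n : x n.*2.+1 = T (y n).
Proof. by rewrite hx hxbar odd_double. Qed.

Lemma even_iterate n : y n.+1 = T (z n).
Proof.
rewrite /y doubleS hx hxbar /= odd_double /= odd_iterate; congr T.
rewrite /z /relax /c scalerDl scale1r opprD addrA subKr -scalerN opprB.
by [].
Qed.

Lemma relaxation_bounds n : 0 <= c n /\ c n * alpha <= 1.
Proof.
have [a0 _] := andP halpha; have /andP[b0] := ha n.*2.+1.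
rewrite ler_pdivlMr // => b1; rewrite /c; split; lra.
Qed.

(** The summable residuals are those of the extrapolated points z_n; the residual
    of y_{n+1} = T z_n is no larger, by nonexpansiveness. *)
Lemma approximate_fixed_point K :
  exists2 n, (n <= Phi alpha M K)%N & norm (y n - T (y n)) <= K.+1%:R^-1.
Proof.
have [a0 a1] := andP halpha.
set t := alpha / (1 - alpha) * M%:R ^+ 2 * K.+1%:R ^+ 2.
have t0 : 0 <= t by rewrite /t !mulr_ge0 ?sqr_ge0 ?invr_ge0 ?subr_ge0 ?(ltW a0) ?(ltW a1).
have zy n : norm (z n - xhat) <= norm (y n - xhat).
  have [c0 c1] := relaxation_bounds n.
  by rewrite -{1}(relax_fix (c n) hxhat); apply: (relax_nonexpansive halpha hT).
set m := maxn 1 (nceil t).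
have [|||n lt_nm zn] := small_residual (delta := K.+1%:R^-1) (m := m) halpha hT hxhat
  even_iterate zy (hMx 0).
- by rewrite invr_gt0.
- by rewrite leq_max.
- have tm : t <= m%:R by apply: le_trans (nceil_ge t0) _; rewrite ler_nat leq_maxr.
  have t_eq : alpha * M%:R ^+ 2 = (1 - alpha) * (t * K.+1%:R^-1 ^+ 2).
    rewrite /t; field.
    by rewrite nat1r pnatr_eq0 subr_eq0 [1 == _]eq_sym (lt_eqF a1).
  by rewrite t_eq ler_wpM2l ?subr_ge0 ?(ltW a1) // ler_wpM2r ?sqr_ge0.
exists n.+1; first by rewrite /Phi -/t -/m; lia.
rewrite even_iterate; apply: le_trans zn; exact: (averaged_nonexpansive halpha hT).
Qed.

Lemma even_almost_fejer q e n l : norm (q - T q) <= e ->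
  norm (y (n + l)%N - q) <= norm (y n - q) + l%:R * ((1 + alpha^-1) * e).
Proof.
have [a0 _] := andP halpha; move=> qe.
apply: (almost_fejer (S := fun n u => T (relax T (c n) u))) => [|m u v|m].
- exact: even_iterate.
- have [c0 c1] := relaxation_bounds m.
  exact: (relax_step_nonexpansive halpha hT).
have [c0 c1] := relaxation_bounds m.
apply: le_trans (relax_step_drift halpha hT q c0 c1) _.
by rewrite ler_wpM2l // addr_ge0 // invr_ge0 ltW.
Qed.

(** Monotonicity of Psi0 lets the single quality demanded at stage n serve all
    earlier indices f i at once. *)
Lemma approximate_fixed_point_chain k g : exists f : nat -> nat, forall n,
  (f n <= Psi0 alpha M n k g)%N /\
  (forall i, (i < n)%N -> norm (y (f n) - T (y (f n))) <=
     (Defs.eta alpha M g k (f i) (4 * k + 3)).+1%:R^-1).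
Proof.
have /choice [f fP] : forall n, exists p, (p <= Psi0 alpha M n k g)%N /\
    ((0 < n)%N -> norm (y p - T (y p)) <=
       (etaM alpha M g k (Psi0 alpha M n.-1 k g) (4 * k + 3)).+1%:R^-1).
  case=> [|n]; first by exists 0%N.
  have [p p_le pT] := approximate_fixed_point
    (etaM alpha M g k (Psi0 alpha M n k g) (4 * k + 3)).
  by exists p; split=> //; exact: leq_trans p_le (Phi_le_PhiM _ _ _).
exists f => n; have [fn fT] := fP n; split=> // i lt_in.
apply: le_trans (fT (leq_ltn_trans (leq0n i) lt_in)) _.
rewrite lef_pV2 ?posrE ?ltr0n // ler_nat ltnS; apply: eta_le_etaM.
have [fi _] := fP i; apply: leq_trans fi _.
by apply: Psi0_mono; lia.
Qed.

(** Distances come from the pigeonhole with eps = 1 / (8 k + 8), and almost-Fejer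
    drift contributes at most as much again. *)
Lemma even_metastable k g : (0 < d)%N -> (0 < M)%N ->
  let P := (nceil ((64 * k + 64)%:R * Num.sqrt d%:R * M%:R : R)%R ^ d)%N in
  exists n q, [/\ (n <= Psi0 alpha M P (2 * k + 1) g)%N,
    norm (q - T q) <= (4 * k + 4)%:R^-1 &
    forall l, (l <= g (2 * n)%N %/ 2)%N -> norm (y (n + l)%N - q) <= (4 * k + 4)%:R^-1].
Proof.
move=> d0 M0; set B := nceil _ => P.
have [f fP] := approximate_fixed_point_chain (2 * k + 1) g.
set r := (4 * (2 * k + 1) + 3)%N in fP.
have r_gt0 : 0 < (r.+1%:R : R) by rewrite ltr0n.
have sd0 : 0 < Num.sqrt (d%:R : R) by rewrite sqrtr_gt0 ltr0n.
have M0R : 0 < (M%:R : R) by rewrite ltr0n.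
have B_large : 2 * M%:R * Num.sqrt d%:R < r.+1%:R^-1 * (B%:R : R).
  rewrite ltr_pdivlMl //.
  apply: (@lt_le_trans _ _ ((64 * k + 64)%:R * Num.sqrt d%:R * M%:R)); last first.
    by apply: nceil_ge; rewrite !mulr_ge0 // ltW.
  rewrite (_ : (64 * k + 64 = 8 * r.+1)%N) ?natrM; last by rewrite /r; lia.
  by have := mulr_gt0 (mulr_gt0 r_gt0 sd0) M0R; lra.
have eps0 : 0 < (r.+1%:R^-1 : R) by rewrite invr_gt0.
have [i [j [lt_ij le_jB yij]]] :=
  ball_pigeonhole (y := fun n => y (f n)) hd eps0 B_large (fun n => hMx _).
have [fi _] := fP i; have [_ fj] := fP j; have {}fj := fj _ lt_ij.
exists (f i), (y (f j)); split.
- by apply: leq_trans fi (Psi0_mono _ _ _ _ _); rewrite (leq_trans (ltnW lt_ij)).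
- apply: le_trans fj _; rewrite lef_pV2 ?posrE ?ltr0n // ?ler_nat; last by lia.
  by rewrite /Defs.eta; lia.
move=> l l_le; apply: le_trans (even_almost_fejer _ _ fj) _.
have : l%:R * ((1 + alpha^-1) * (Defs.eta alpha M g (2 * k + 1) (f i) r).+1%:R^-1)
    <= (r.+1%:R^-1 : R).
  apply: le_trans (eta_modulus g (2 * k + 1) (f i) r halpha M0).
  rewrite ler_wpM2r ?ler_nat // mulr_ge0 ?invr_ge0 // addr_ge0 // invr_ge0 ltW //.
  by case/andP: halpha.
have -> : ((4 * k + 4)%:R^-1 : R) = 2 * r.+1%:R^-1.
  rewrite (_ : r.+1 = (2 * (4 * k + 4))%N) ?natrM; last by rewrite /r; lia.
  by rewrite invfM mulrA divff ?pnatr_eq0 ?mul1r.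
by move=> ?; rewrite [leRHS]mulr_natl mulr2n lerD.
Qed.

(** The window [N, N + g N] with N = 2 n + 3 lies in [2 n, 2 n + g (2 n + 3) + 3],
    which is why the even sequence is run with the shifted function g'. If d or
    M vanishes, the strict lower bound on the number of boxes that the pigeonhole
    needs may fail, but then x is constantly xhat. *)
Lemma iteration_metastable k g : exists2 N : nat, (N <= Psi alpha M d k g)%N &
  forall i j : nat, (N <= i <= N + g N)%N -> (N <= j <= N + g N)%N ->
    norm (x i - x j) <= k.+1%:R^-1 /\ norm (x i - T (x i)) <= k.+1%:R^-1.
Proof.
have [|dM_gt0] := posnP (d * M)%N.
  move=> /eqP; rewrite muln_eq0 => dM.
  have x_hat n : x n = xhat.
    apply/eqP; rewrite -subr_eq0; case/orP: dM => /eqP dM.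
      by rewrite -memv0; have : (x n - xhat \in {:X})%VS := memvf _;
         rewrite (_ : {:X}%VS = 0%VS) //; apply/eqP; rewrite -dimv_eq0 hd dM.
    by rewrite (hnorm_le0 (dot := dot) (u := _ - _)) //; have := hMx n; rewrite dM.
  exists 0%N => // i j _ _; rewrite !x_hat hxhat subrr hnorm0.
  by rewrite invr_ge0 ler0n.
move: dM_gt0; rewrite muln_gt0 => /andP[d0 M0].
pose g' n := (g (n + 3) + 3)%N.
have [n [q [n_le qe yq]]] := even_metastable k g' d0 M0.
pose N := (2 * n + 3)%N; exists N; first by rewrite /N /Psi leq_add2r leq_mul2l n_le orbT.
have near i : (N <= i <= N + g N)%N ->
    norm (x i - q) <= 2 * (4 * k + 4)%:R^-1 /\ norm (x i - T (x i)) <= 4 * (4 * k + 4)%:R^-1.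
  move=> iN; have [l [l_le iE]] : exists l, (l <= g' (2 * n)%N %/ 2)%N /\
      (i = (n + l).*2 \/ i = (n + l).*2.+1).
    by exists (i %/ 2 - n)%N; rewrite /g' -/N; move: iN; rewrite /N; lia.
  have [] := near_approximate_fixed_point halpha hT qe (yq _ l_le).
  by case: iE => ->; rewrite ?odd_iterate.
move=> i j /near [xi Ti] /near [xj _].
have -> : (k.+1%:R^-1 : R) = 4 * (4 * k + 4)%:R^-1.
  rewrite (_ : (4 * k + 4 = 4 * k.+1)%N) ?natrM; last by lia.
  by rewrite invfM mulrA divff ?pnatr_eq0 ?mul1r.
split=> //; apply: le_trans (ler_hdist _ q _ _) _; lra.
Qed.

End Iteration.

Unset Implicit Arguments.

Theorem theorem7p10 (R : realType) (X : vectType R) (dot : {dot X for idfun})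
  (d : nat) (hd : \dim {: X}%VS = d)
  (alpha : R) (halpha : 0 < alpha < 1)
  (T : X -> X) (hT : averaged dot alpha T)
  (xhat : X) (hxhat : T xhat = xhat)
  (a : nat -> R) (ha : forall k : nat, 0 <= a k <= (1 - alpha) / alpha)
  (x xbar : nat -> X)
  (hx : forall k : nat, x k.+1 = T (xbar k))
  (hxbar : forall k : nat,
     xbar k = if odd k then x k + a k *: (x k - x k.-1) else x k)
  (M : nat)
  (hMx : forall k : nat, hnorm dot (x k - xhat) <= M%:R)
  (hMxbar : forall k : nat, hnorm dot (xbar k - xhat) <= M%:R) :
  cauchy_sequence dot x /\
  forall (k : nat) (g : nat -> nat),
    exists2 N : nat, (N <= Psi alpha M d k g)%N &
      forall i j : nat, (N <= i <= N + g N)%N -> (N <= j <= N + g N)%N ->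
        hnorm dot (x i - x j) <= k.+1%:R^-1 /\
        x i \in AF dot T (cball dot xhat M%:R) k.
Proof.
have meta := iteration_metastable hd halpha hT hxhat ha hx hxbar hMx.
split.
  apply: metastable_cauchy => k g; have [N _ NP] := meta k g.
  by exists N => i j Ni Nj; have [] := NP i j Ni Nj.
move=> k g; have [N N_le NP] := meta k g; exists N => // i j Ni Nj.
have [xij xi] := NP i j Ni Nj; split=> //.
by rewrite !inE hMx.
Qed.
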